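(* Let $n\ge 1$ and $N=2^n$. The minimum size of a training dataset of (possibly mixed) $n$-qubit states that is sufficient for learning an $n$-qubit unitary is $t_{\min}=2$. That is: (i) there exist density matrices $\rho,\sigma$ on $\mathbb{C}^N$ such that for every unitary $U$ on $\mathbb{C}^N$ the dataset $\{(\rho,U\rho U^\dagger),(\sigma,U\sigma U^\dagger)\}$ is sufficient for learning $U$; and (ii) for every density matrix $\rho$ on $\mathbb{C}^N$ and every unitary $U$ on $\mathbb{C}^N$, the one-element dataset $\{(\rho,U\rho U^\dagger)\}$ is not sufficient for learning $U$.
   Context: An $n$-qubit system has Hilbert space $\mathbb{C}^N$ with $N=2^n$. For unitaries $U,V$ on $\mathbb{C}^N$ the quantum risk is $$R_U(V)=1-\int |\langle\psi|U^\dagger V|\psi\rangle|^2\,d|\psi\rangle=1-\frac{N+|\operatorname{Tr}[U^\dagger V]|^2}{N(N+1)},$$ where the integral is over pure states with the uniform (Haar) probability measure. For density matrices $\rho_1,\dots,\rho_t$ and a target unitary $U$, the training dataset is $\{(\rho_j,U\rho_jU^\dagger)\}_{j=1}^t$. A unitary $V$ (the quantum machine learning model) is perfectly trained on this dataset if $V\rho_jV^\dagger=U\rho_jU^\dagger$ for all $j$ (zero empirical risk). The dataset is sufficient for learning $U$ if every perfectly trained unitary $V$ satisfies $R_U(V)=0$, and is not sufficient otherwise. *)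

(* Defs.v *)
From HB Require Import structures.
From mathcomp Require Import all_boot all_order all_algebra.
From mathcomp Require Import complex.
From mathcomp Require Import all_classical all_reals all_analysis.

Set Implicit Arguments.
Unset Strict Implicit.
Unset Printing Implicit Defensive.

Import Order.TTheory GRing.Theory Num.Theory.
Import numFieldNormedType.Exports.
Import ComplexField.

Local Open Scope classical_set_scope.
Local Open Scope ring_scope.
Local Open Scope complex_scope.
Local Open Scope sesquilinear_scope.

(* C^N with its Borel sigma-algebra; (R[i])^o carries the topology of the
   complex modulus. *)
Definition cvect (R : realType) (N : nat) :=
  g_sigma_algebraType (@open ('cV[(R[i])^o]_N)).

(* Pure states are represented by unit vectors: the quantity integrated below
   does not change when the vector is multiplied by a phase. *)
Definition pure_states (R : realType) (N : nat) : set (cvect R N) :=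
  [set psi : 'cV[R[i]]_N | psi^t* *m psi = 1%:M].

(* The uniform (Haar) distribution on pure states is the unique
   unitarily invariant Borel probability measure carried by the unit sphere. *)
Definition haar_pure_state (R : realType) (N : nat)
    (mu : probability (cvect R N) R) : Prop :=
  mu (@pure_states R N) = 1%E /\
  forall W : 'M[R[i]]_N, W \is unitarymx ->
  forall A : set (cvect R N), measurable A ->
    mu [set psi : 'cV[R[i]]_N | A (W *m psi)] = mu A.

Definition quantum_risk (R : realType) (N : nat)
    (mu : probability (cvect R N) R) (U V : 'M[R[i]]_N) : R :=
  1 - \int[mu]_(psi in @pure_states R N)
        (Normc.normc ((psi^t* *m (U^t* *m V) *m psi) 0 0) ^+ 2).

Definition density (R : realType) (N : nat) (rho : 'M[R[i]]_N) : Prop :=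
  [/\ rho \is hermsymmx,
      forall v : 'cV[R[i]]_N, 0 <= (v^t* *m rho *m v) 0 0
    & \tr rho = 1].

Definition training_dataset (R : realType) (N : nat) (U : 'M[R[i]]_N)
    (rhos : seq 'M[R[i]]_N) : seq ('M[R[i]]_N * 'M[R[i]]_N) :=
  [seq (rho, U *m rho *m U^t*) | rho <- rhos].

Definition perfectly_trained (R : realType) (N : nat)
    (D : seq ('M[R[i]]_N * 'M[R[i]]_N)) (V : 'M[R[i]]_N) : Prop :=
  forall p, p \in D -> V *m p.1 *m V^t* = p.2.

Definition sufficient (R : realType) (N : nat)
    (mu : probability (cvect R N) R)
    (D : seq ('M[R[i]]_N * 'M[R[i]]_N)) (U : 'M[R[i]]_N) : Prop :=
  forall V : 'M[R[i]]_N, V \is unitarymx ->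
    perfectly_trained D V -> quantum_risk mu U V = 0.

Definition sufficient_size (R : realType) (N : nat)
    (mu : probability (cvect R N) R) (U : 'M[R[i]]_N) (t : nat) : Prop :=
  exists rhos : seq 'M[R[i]]_N,
    [/\ size rhos = t,
        forall rho, rho \in rhos -> density rho
      & sufficient mu (training_dataset U rhos) U].

Definition is_minimum (P : nat -> Prop) (m : nat) : Prop :=
  P m /\ forall t, P t -> (m <= t)%N.

(* Main.v *)
Require Import Defs.
From HB Require Import structures.
From mathcomp Require Import all_boot all_order all_algebra.
From mathcomp Require Import complex.
From mathcomp Require Import all_classical all_reals all_analysis.
From mathcomp Require Import measurable_realfun.

(** Put W = U^* V.  The model V is perfectly trained on rho iff W commutes with
    rho.  A diagonal state with distinct eigenvalues together with the
    projector on the uniform vector forces W to be scalar, so the risk is 0.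

    Conversely, diagonalize a single state, rho = P^* diag(d) P, and take
    W = P^* F P with F = diag(-1, 1, ..., 1), which commutes with rho.  On a
    unit vector, <psi|W|psi> = 1 - 2 |(P psi)_0|^2 has modulus 1 only if
    |(P psi)_0|^2 is 0 or 1.  If the risk were 0 this would hold almost surely,
    and then, by unitary invariance, with any unitary X in place of P: almost
    every psi would have all |psi_i|^2, as well as its squared overlap with
    the uniform vector, in {0, 1}.  But such a psi would be a basis vector up to
    a phase, whose squared overlap with the uniform vector is 1/N. *)

Set Implicit Arguments.
Unset Strict Implicit.
Unset Printing Implicit Defensive.

Import Order.TTheory GRing.Theory Num.Theory.
Import numFieldNormedType.Exports.

Local Open Scope classical_set_scope.
Local Open Scope ring_scope.
Local Open Scope complex_scope.
Local Open Scope sesquilinear_scope.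

(** * Unitaries, reflections and unit vectors *)

Section Algebra.
Variables (C : numClosedFieldType) (N : nat).
Implicit Types (v psi : 'cV[C]_N) (A B W P : 'M[C]_N).

Lemma trmxC_mul m n p (A : 'M[C]_(m, n)) (B : 'M[C]_(n, p)) :
  (A *m B)^t* = B^t* *m A^t*.
Proof. by rewrite trmx_mul map_mxM. Qed.

Lemma unitarymxKl W : W \is unitarymx -> W^t* *m W = 1%:M.
Proof. by move/unitarymxP/mulmx1C. Qed.

Lemma unit_sphere_sum psi :
  psi^t* *m psi = 1%:M -> \sum_i `|psi i 0| ^+ 2 = 1.
Proof.
move=> /matrixP/(_ 0 0); rewrite !mxE eqxx mulr1n => <-.
by apply: eq_bigr => i _; rewrite !mxE normCKC.
Qed.

Lemma unitary_unit_sphere W psi : W \is unitarymx ->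
  psi^t* *m psi = 1%:M -> (W *m psi)^t* *m (W *m psi) = 1%:M.
Proof.
by move=> uW upsi; rewrite trmxC_mul mulmxA -(mulmxA _ _ W) unitarymxKl ?mulmx1.
Qed.

(** Gram-Schmidt is applied to the matrix all of whose rows are [v^*]. The first row it returns
    spans the same line as [v^*], hence equals it up to a phase, and the later rows complete it to
    an orthonormal basis. *)
Lemma unitary_row0 v (i0 : 'I_N) : i0 = 0 :> nat -> v^t* *m v = 1%:M ->
  exists2 W, W \is unitarymx &
    forall psi, `|(W *m psi) i0 0| = `|(v^t* *m psi) 0 0|.
Proof.
move=> i00 uv; pose A := \matrix_(i < N) v^t*; pose W := schmidt A.
have uW : W \is unitarymx by exact: schmidt_unitarymx.
exists W => // psi.
have : (v^t* <= row i0 W)%MS.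
  have := row_schmidt_sub A i0; rewrite rowK => /submx_trans; apply.
  apply/sumsmx_subP => k; rewrite i00 leqn0 => /eqP k0.
  by rewrite (_ : k = i0) ?genmxE//; apply: val_inj; rewrite /= k0.
move=> /sub_rVP[a va].
have rW : row i0 W *m (row i0 W)^t* = 1%:M.
  have /unitarymxP/matrixP/(_ i0 i0) := uW.
  rewrite !mxE eqxx => WW; apply/matrixP => i j; rewrite !ord1 !mxE eqxx -WW.
  by apply: eq_bigr => k _; rewrite !mxE.
(* Both [v] and row [i0] of [W] have norm 1, so the factor [a] between them is a phase. *)
have a1 : `|a| = 1.
  apply/eqP; rewrite -sqrp_eq1 ?normr_ge0//; apply/eqP.
  have := uv; rewrite -[X in _ *m X](trmxCK v) va linearZ/= map_mxZ.
  rewrite -scalemxAl -scalemxAr rW scalerA => /matrixP/(_ 0 0).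
  by rewrite !mxE eqxx !mulr1n mulr1 normCK.
rewrite va -scalemxAl [in RHS]mxE normrM a1 mul1r -row_mul.
by rewrite [in RHS]mxE.
Qed.

(** The reflection [1 - 2 |i0><i0|]; the boolean [j == i0] serves as exponent of the sign. *)
Definition flip0 (i0 : 'I_N) : 'M[C]_N :=
  diag_mx (\row_j (-1) ^+ (j == i0)).

Lemma flip0_sqr i0 : flip0 i0 *m flip0 i0 = 1%:M.
Proof.
apply/matrixP => i j; rewrite mul_diag_mx !mxE.
by rewrite mulrnAr -expr2 sqrr_sign.
Qed.

Lemma flip0_adj i0 : (flip0 i0)^t* = flip0 i0.
Proof.
apply/matrixP => i j; rewrite !mxE rmorphMn/= rmorphXn/= rmorphN1.
by case: (eqVneq i j) => // ->.
Qed.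

Lemma flip0_unitary i0 : flip0 i0 \is unitarymx.
Proof. by apply/unitarymxP; rewrite flip0_adj flip0_sqr. Qed.

Lemma flip0_form i0 psi : psi^t* *m psi = 1%:M ->
  (psi^t* *m flip0 i0 *m psi) 0 0 = 1 - 2 * `|psi i0 0| ^+ 2.
Proof.
move=> /unit_sphere_sum s1; rewrite -[X in X - _]s1.
rewrite mul_mx_diag mxE (bigD1 i0)//= [in RHS](bigD1 i0)//=.
rewrite addrAC; congr (_ + _).
  by rewrite !mxE eqxx mulrN1 mulNr -normCKC mulr_natl mulr2n opprD addNKr.
by apply: eq_bigr => j ji; rewrite !mxE (negPf ji) mulr1 normCKC.
Qed.

(** The expectation [1 - 2 x], with [x] the squared modulus of coordinate [i0], is real; modulus 1
    leaves only the values 1 and -1, that is [x = 0] or [x = 1]. *)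
Lemma flip0_form_norm1 i0 psi : psi^t* *m psi = 1%:M ->
  `|(psi^t* *m flip0 i0 *m psi) 0 0| = 1 ->
  `|psi i0 0| ^+ 2 \in [:: 0; 1].
Proof.
move=> /flip0_form ->; set x := `|_| ^+ 2.
have xr : 1 - 2 * x \is Num.real.
  by rewrite realB// realM ?realn// rpredX ?normr_real.
move=> /eqP; rewrite real_eqr_norml// ler01 andbT => /orP[] /eqP.
  move=> /(congr1 (fun z => 1 - z)); rewrite subKr subrr => /eqP.
  by rewrite mulf_eq0 pnatr_eq0/= inE => ->.
move=> /(congr1 (fun z => 1 - z)); rewrite subKr opprK.
rewrite -[RHS](mulr1 2) => /mulfI ->; first by rewrite !inE eqxx orbT.
by rewrite pnatr_eq0.
Qed.

Lemma flip0_form_le1 i0 psi : psi^t* *m psi = 1%:M ->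
  `|(psi^t* *m flip0 i0 *m psi) 0 0| <= 1.
Proof.
move=> upsi; rewrite flip0_form//; set x := `|_| ^+ 2.
have x0 : 0 <= x by rewrite exprn_ge0.
have x1 : x <= 1.
  rewrite -(unit_sphere_sum upsi) (bigD1 i0)//= lerDl.
  by apply: sumr_ge0 => j _; rewrite exprn_ge0.
rewrite real_ler_norml ?realB ?realM ?realn ?ger0_real//.
rewrite gerBl mulr_ge0// andbT lerBrDr addrC lerBlDr.
by rewrite [leRHS](_ : _ = 2 * 1) ?ler_pM2l ?ltr0n// mulr1.
Qed.

(** In an eigenbasis of [A], given by the spectral theorem, the reflection and [A] are both
    diagonal. They commute, and the two reflections cancel. *)
Lemma hermitian_flip (i0 : 'I_N) A : A \is hermsymmx ->
  exists2 P, P \is unitarymx &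
    let W := P^t* *m flip0 i0 *m P in W *m A *m W^t* = A.
Proof.
move=> /hermitian_normalmx/orthomx_spectralP.
set P := spectralmx A; set d := spectral_diag A => defA.
have uP : P \is unitarymx := spectral_unitarymx A.
exists P => //=; move: defA; rewrite invmx_unitary// => {1 2}->.
rewrite !trmxC_mul trmxCK flip0_adj !mulmxA.
rewrite -(mulmxA _ P (P^t*)) (unitarymxP uP) mulmx1.
rewrite -(mulmxA _ P (P^t*)) (unitarymxP uP) mulmx1.
rewrite -!(mulmxA (P^t*)) (diag_mxC _ d) -!mulmxA (mulmxA (flip0 i0)).
by rewrite flip0_sqr mul1mx.
Qed.

(** Entry [(i, j)] of the first commutation reads [W i j * (d j - d i) = 0], which kills the
    off-diagonal part. Entry [(i, j)] of the second then reads [W i i * c = c * W j j]. *)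
Lemma commute_diag_const_scalar (d : 'rV[C]_N) c W : c != 0 ->
  injective (d 0) ->
  W *m diag_mx d = diag_mx d *m W ->
  W *m const_mx c = const_mx c *m W -> is_scalar_mx W.
Proof.
move=> c0 dI Wd W1.
have W0 i j : i != j -> W i j = 0.
  move=> ij; have /matrixP/(_ i j) := Wd; rewrite mul_mx_diag mul_diag_mx !mxE.
  rewrite mulrC => /eqP; rewrite -subr_eq0 -mulrBl mulf_eq0 subr_eq0.
  by rewrite (inj_eq dI) eq_sym (negPf ij) => /eqP.
have WE i j : W i i = W j j.
  have /matrixP/(_ i j) := W1; rewrite !mxE (bigD1 i)//= [in RHS](bigD1 j)//=.
  have -> : \sum_(k | k != i) W i k * const_mx c k j = 0.
    by apply: big1 => k ki; rewrite W0 ?mul0r// eq_sym.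
  have -> : \sum_(k | k != j) const_mx c i k * W k j = 0.
    by apply: big1 => k kj; rewrite W0 ?mulr0.
  by rewrite !addr0 !mxE mulrC => /(mulfI c0).
(* If [N = 0] there is no diagonal entry to take as the scalar, and 0 serves. *)
apply/is_scalar_mxP; case: (pickP 'I_N) => [i _|N0]; last first.
  by exists 0; apply/matrixP => i; have := N0 i.
exists (W i i); apply/matrixP => j k; rewrite mxE.
by case: eqVneq => [->|/W0->//]; rewrite mulr1n; apply: WE.
Qed.

(** The excluded quantity is the squared overlap with the uniform vector. Since the squared moduli
    sum to 1, exactly one entry is nonzero, and the overlap is [1/N]. *)
Lemma flat_vector_contra psi : (1 < N)%N -> psi^t* *m psi = 1%:M ->
  (forall i, `|psi i 0| ^+ 2 \in [:: 0; 1]) ->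
  N%:R^-1 * `|\sum_i psi i 0| ^+ 2 \notin [:: 0; 1].
Proof.
move=> N1 /unit_sphere_sum s1 p01.
have /existsP[i /eqP pi] : [exists i, `|psi i 0| ^+ 2 == 1].
  apply: contraT => /existsPn h; move/eqP: s1; rewrite big1.
    by rewrite eq_sym oner_eq0.
  by move=> i _; move: (p01 i) (h i); rewrite !inE => /orP[/eqP//|->].
move: s1; rewrite (bigD1 i)//= pi -[RHS]addr0 => /addrI/eqP.
rewrite psumr_eq0 => [/allP p0|j _]; last by rewrite exprn_ge0.
rewrite (bigD1 i)//= big1 ?addr0 ?pi => [|j ji].
  rewrite mulr1 !inE negb_or invr_eq0 pnatr_eq0 invr_eq1 -lt0n ltnW//=.
  by rewrite (eqr_nat _ _ 1) gtn_eqF.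
by move: (p0 j); rewrite mem_index_enum ji sqrf_eq0 normr_eq0 => /(_ isT)/eqP.
Qed.

Lemma delta_unit (i : 'I_N) :
  (delta_mx i 0 : 'cV[C]_N)^t* *m delta_mx i 0 = 1%:M.
Proof.
rewrite trmx_delta map_delta_mx mul_delta_mx.
by apply/matrixP => a b; rewrite !ord1 !mxE.
Qed.

Lemma delta_adj_mul (i : 'I_N) psi :
  ((delta_mx i 0 : 'cV[C]_N)^t* *m psi) 0 0 = psi i 0.
Proof. by rewrite trmx_delta map_delta_mx -rowE mxE. Qed.

Definition uniform_vector : 'cV[C]_N := const_mx (sqrtC N%:R)^-1.

Lemma sqr_norm_uniform_coef : `|(sqrtC N%:R : C)^-1| ^+ 2 = N%:R^-1.
Proof. by rewrite normfV exprVn ger0_norm ?sqrtC_ge0 ?ler0n// sqrtCK. Qed.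

Lemma uniform_vector_unit : (0 < N)%N ->
  uniform_vector^t* *m uniform_vector = 1%:M.
Proof.
move=> N0; apply/matrixP => a b; rewrite !ord1 !mxE eqxx mulr1n.
under eq_bigr do rewrite !mxE -normCKC sqr_norm_uniform_coef.
by rewrite sumr_const card_ord -[LHS]mulr_natl mulfV// pnatr_eq0 -lt0n.
Qed.

(** This identifies the second training state as a constant matrix, the form needed in
    [commute_diag_const_scalar]. *)
Lemma uniform_vector_projector :
  uniform_vector *m uniform_vector^t* = const_mx N%:R^-1.
Proof.
apply/matrixP => i j; rewrite mxE big_ord1 !mxE -normCK.
exact: sqr_norm_uniform_coef.
Qed.

Lemma uniform_vector_overlap psi :
  `|(uniform_vector^t* *m psi) 0 0| ^+ 2 = N%:R^-1 * `|\sum_i psi i 0| ^+ 2.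
Proof.
rewrite mxE; under eq_bigr do rewrite !mxE.
by rewrite -mulr_sumr normrM exprMn Num.Theory.norm_conjC sqr_norm_uniform_coef.
Qed.

End Algebra.

(** * Measurability and integration on the space of vectors *)

Lemma norm_normc (R : realType) (z : R[i]) : `|z| = (Normc.normc z)%:C.
Proof. by case: z. Qed.

(** The expectation is a finite sum of products of coordinates, their conjugates and constants;
    conjugation is continuous because it is an isometry. *)
Lemma expectation_continuous (K : numClosedFieldType) N (W : 'M[K]_N) :
  continuous (fun psi : 'cV[K]_N => ((psi^t* *m W *m psi) 0 0 : K)).
Proof.
have conjC_cvg : continuous (fun z : K => Num.conj z).
  move=> z; have F : Filter (nbhs z) by typeclasses eauto.
  apply: (proj2 (@cvgrPdist_lt K K K (nbhs z) _ Num.conj (Num.conj z))) => e e0.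
  near=> w; rewrite -rmorphB Num.Theory.norm_conjC; near: w.
  by apply: (proj1 (@cvgrPdist_lt K K K (nbhs z) _ id z)) e0; exact: cvg_id.
rewrite (_ : (fun _ => _) = fun psi : 'cV[K]_N =>
   \sum_j (\sum_i Num.conj (psi i 0) * W i j) * psi j 0); last first.
  apply/funext => psi; rewrite mxE; apply: eq_bigr => j _.
  by rewrite mxE; congr (_ * _); apply: eq_bigr => i _; rewrite !mxE.
have sumc (f : 'I_N -> 'cV[K]_N -> K) :
    (forall i, continuous (f i)) -> continuous (fun psi => \sum_i f i psi).
  move=> cf psi; apply: (@cvg_big K _ _ _ _ _ _ (nbhs psi)) => [|i _].
  - exact: add_continuous.
  - exact: cf.
have mulc (f g : 'cV[K]_N -> K) :
    continuous f -> continuous g -> continuous (fun psi => f psi * g psi).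
  by move=> cf cg psi; apply: (@cvgM K _ (nbhs psi)); [exact: cf|exact: cg].
apply: (sumc (fun j psi => (\sum_i Num.conj (psi i 0) * W i j) * psi j 0)) => j.
apply: (mulc (fun psi => \sum_i Num.conj (psi i 0) * W i j) (fun psi => psi j 0));
  last exact: coord_continuous.
apply: (sumc (fun i psi => Num.conj (psi i 0) * W i j)) => i.
apply: (mulc (fun psi => Num.conj (psi i 0)) (fun=> W i j));
  last exact: cst_continuous.
move=> psi; apply: (@cvg_comp _ _ _ (fun M : 'cV[K]_N => M i 0) Num.conj
  _ (nbhs (psi i 0))).
  exact: coord_continuous.
exact: conjC_cvg.
Unshelve. all: by end_near. Qed.

(** By the reverse triangle inequality. It is an inequality in [R[i]], where moduli are complex
    numbers, and is brought back to [R] through the embedding. *)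
Lemma normc_continuous (R : realType) :
  continuous (fun z : (R[i])^o => Normc.normc z : R).
Proof.
move=> z; have F : Filter (nbhs z) by typeclasses eauto.
apply: (proj2 (@cvgrPdist_lt R R^o (R[i])^o (nbhs z) _ _ _)) => e e0; near=> w.
have := ler_dist_dist (z : R[i]) w.
rewrite (norm_normc z) (norm_normc w) -rmorphB [X in X <= _ -> _]norm_normc.
rewrite /Normc.normc/= expr0n addr0 sqrtr_sqr => zw.
rewrite -ltcR; apply: (le_lt_trans zw).
near: w.
apply: (proj1 (@cvgrPdist_lt R[i] (R[i])^o (R[i])^o (nbhs z) _ id z)).
  exact: cvg_id.
by rewrite ltcR.
Unshelve. all: by end_near. Qed.

Lemma open_preimage_measurable (R : realType) N (T : topologicalType)
    (f : 'cV[(R[i])^o]_N -> T) (B : set T) :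
  continuous f -> open B -> measurable (f @^-1` B : set (cvect R N)).
Proof.
by move=> /continuousP cf oB; apply: sub_sigma_algebra; exact: cf.
Qed.

(** Open intervals generate the Borel sets of [R], and their preimages under this continuous map are
    open. *)
Lemma expectation_measurable (R : realType) N (W : 'M[R[i]]_N) :
  measurable_fun [set: cvect R N] (fun psi : cvect R N =>
    Normc.normc ((((psi : 'cV[R[i]]_N)^t* *m W) *m (psi : 'cV[R[i]]_N)) 0 0) : R).
Proof.
apply: (measurability _ (RGenOpens.measurableE R)) => _ [_ [a [b ->]] <-].
rewrite setTI.
apply: (@open_preimage_measurable R N R
  (fun psi => Normc.normc ((psi^t* *m W *m psi) 0 0))).
  move=> psi; apply: (@continuous_comp _ _ _ (fun psi : 'cV[(R[i])^o]_N =>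
    (((psi : 'cV[R[i]]_N)^t* *m W *m psi) 0 0 : (R[i])^o)) (fun z => Normc.normc z)).
    exact: (@expectation_continuous R[i] N W).
  exact: normc_continuous.
exact: interval_open.
Qed.

(** The unit sphere is closed: its complement is the preimage of the complement of 1 under the
    expectation of the identity matrix. *)
Lemma pure_states_measurable (R : realType) N : measurable (@pure_states R N).
Proof.
rewrite -[X in measurable X]setCK; apply: measurableC.
rewrite (_ : ~` _ = (fun psi : 'cV[(R[i])^o]_N =>
    (((psi : 'cV[R[i]]_N)^t* *m 1%:M *m psi) 0 0 : (R[i])^o)) @^-1` ~` [set 1]).
  apply: open_preimage_measurable.
    exact: (@expectation_continuous R[i] N 1%:M).
  by apply: closed_openC; apply: accessible_closed_set1;
  apply: hausdorff_accessible; exact: (@norm_hausdorff R[i] (R[i])^o).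
rewrite -preimage_setC; congr (~` _); apply/seteqP; split => psi /=.
  by rewrite mulmx1 => ->; rewrite mxE.
by rewrite mulmx1 => h; apply/matrixP => i j; rewrite !ord1 h mxE.
Qed.

(** Since [D] has mass 1, the nonnegative function [1 - f] has integral 0 over [D], so it vanishes
    almost everywhere there. *)
Lemma Rintegral_eq1_ae d (T : measurableType d) (R : realType)
    (mu : probability T R) (D : set T) (f : T -> R) :
  measurable D -> mu D = 1%E -> measurable_fun D f ->
  (forall x, D x -> 0 <= f x <= 1) -> \int[mu]_(x in D) f x = 1 ->
  mu (D `&` f @^-1` [set~ 1]) = 0%E.
Proof.
move=> mD D1 mf f01 if1.
have D1' : (mu : {measure set T -> \bar R}) D = 1%E by [].
have fi : mu.-integrable D (EFin \o f).
  apply: measurable_bounded_integrable => //; first by rewrite D1' ltry.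
  exists 1; split; rewrite ?real1// => M M1 x Dx /=.
  by have /andP[f0 f1] := f01 _ Dx; rewrite ger0_norm// (le_trans f1)// ltW.
have ci : mu.-integrable D (EFin \o cst (1 : R)).
  apply: measurable_bounded_integrable => //; first by rewrite D1' ltry.
  exists 1; split; rewrite ?real1// => M M1 x Dx /=.
  by rewrite normr1 ltW.
have gi := integrableB mD ci fi.
have ig0 : \int[mu]_(x in D) (1 - f x) = 0.
  rewrite RintegralB// if1 Rintegral_cst// D1' /= mulr1 subrr//.
have : ae_eq mu D (fun x => (1 - f x)%:E) (cst 0%E).
  apply/ae_eq_integral_abs => //.
    by apply/measurable_EFinP; apply: measurable_funB.
  have gfin := integrable_fin_num mD gi.
  rewrite -[RHS](congr1 EFin ig0) /Rintegral fineK//.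
  apply: eq_integral => x /set_mem Dx; rewrite gee0_abs// lee_fin subr_ge0.
  by case/andP: (f01 _ Dx).
move=> ae0; apply: measure_negligible.
  by apply: mf => //; exact: measurableC.
apply: negligibleS ae0 => x /= [Dx f1] /(_ Dx)[] /eqP.
by rewrite subr_eq0 eq_sym => /eqP.
Qed.

(** * The integrand of the risk, as a function of [W = U^* V] *)

Definition overlap (R : realType) N (W : 'M[R[i]]_N) (psi : cvect R N) : R :=
  Normc.normc ((((psi : 'cV[R[i]]_N)^t* *m W) *m (psi : 'cV[R[i]]_N)) 0 0) ^+ 2.

(* On pure states the overlap of a unitary W is at most 1 (Cauchy-Schwarz), so a
   vanishing risk makes these states negligible. *)
Definition lossy_states (R : realType) N (W : 'M[R[i]]_N) : set (cvect R N) :=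
  @pure_states R N `&` @overlap R N W @^-1` [set~ 1].

Lemma overlap_measurable (R : realType) N (W : 'M[R[i]]_N) D :
  measurable_fun D (@overlap R N W).
Proof.
apply: measurable_funS (_ : measurable_fun setT _) => //.
by apply: measurable_funX; exact: expectation_measurable.
Qed.

Lemma lossy_states_measurable (R : realType) N (W : 'M[R[i]]_N) :
  measurable (@lossy_states R N W).
Proof.
apply: overlap_measurable; first exact: pure_states_measurable.
exact: measurableC.
Qed.

Lemma overlapE (R : realType) N (W : 'M[R[i]]_N) (psi : 'cV[R[i]]_N) :
  (overlap W psi)%:C = `|(psi^t* *m W *m psi) 0 0| ^+ 2.
Proof. by rewrite norm_normc -rmorphXn. Qed.

Lemma overlap_eq1 (R : realType) N (W : 'M[R[i]]_N) (psi : 'cV[R[i]]_N) :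
  overlap W psi = 1 <-> `|(psi^t* *m W *m psi) 0 0| = 1.
Proof.
have e := overlapE W psi; split => [h|h]; move: e; rewrite h.
  by move/esym/eqP; rewrite sqrp_eq1// => /eqP.
by rewrite expr1n => /(congr1 (@complex.Re R)).
Qed.

Lemma overlap_le1 (R : realType) N (W : 'M[R[i]]_N) (psi : 'cV[R[i]]_N) :
  `|(psi^t* *m W *m psi) 0 0| <= 1 -> 0 <= overlap W psi <= 1.
Proof.
by move=> h; rewrite sqr_ge0 -lecR overlapE exprn_ile1.
Qed.

(** * The risk under the Haar measure *)

Section Haar.
Variables (R : realType) (N : nat) (mu : probability (cvect R N) R).
Hypothesis hmu : haar_pure_state mu.

(** A unitary scalar matrix is a phase, so the integrand is 1 at every pure state. *)
Lemma quantum_risk_scalar (U V : 'M[R[i]]_N) : is_scalar_mx (U^t* *m V) ->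
  U \is unitarymx -> V \is unitarymx -> quantum_risk mu U V = 0.
Proof.
move=> /is_scalar_mxP[a Wa] uU uV; rewrite /quantum_risk.
rewrite (@eq_Rintegral _ _ _ _ _ (cst 1)); last first.
  move=> psi; rewrite inE => Spsi; apply/overlap_eq1; rewrite Wa.
  have : (U^t* *m V) \is unitarymx by rewrite mul_unitarymx// trmxC_unitary.
  rewrite Wa => /unitary_unit_sphere/(_ Spsi).
  rewrite mul_scalar_mx [(a *: _)^T]linearZ/= map_mxZ.
  rewrite -scalemxAl -scalemxAr scalerA Spsi.
  move=> /matrixP/(_ 0 0).
  rewrite mul_mx_scalar -scalemxAl Spsi !mxE eqxx mulr1n !mulr1.
  rewrite mulrC -normCK => /eqP.
  by rewrite sqrp_eq1 ?normr_ge0// => /eqP.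
rewrite Rintegral_cst ?mul1r; last exact: pure_states_measurable.
have mu1 : (mu : {measure set _ -> \bar R}) (@pure_states R N) = 1%E := hmu.1.
by rewrite mu1 subrr.
Qed.

(** The first set is the preimage of the second under [psi -> P psi], which preserves [mu]. *)
Lemma lossy_states_conj (P W : 'M[R[i]]_N) : P \is unitarymx ->
  mu (lossy_states (P^t* *m W *m P)) = mu (lossy_states W).
Proof.
move=> uP; rewrite -[RHS](hmu.2 P uP); last exact: lossy_states_measurable.
congr (mu _); apply/seteqP.
have E psi : overlap (P^t* *m W *m P) psi = overlap W (P *m psi).
  by rewrite /overlap trmxC_mul !mulmxA.
have S (psi : 'cV[R[i]]_N) :
    (P *m psi)^t* *m (P *m psi) = 1%:M -> psi^t* *m psi = 1%:M.
  by rewrite trmxC_mul mulmxA -(mulmxA _ _ P) unitarymxKl ?mulmx1.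
split=> psi [Spsi ne1]; split.
- exact: unitary_unit_sphere.
- by move: ne1; rewrite /= E.
- exact: S.
- by rewrite /= E.
Qed.

Lemma flip0_risk_neq0 (i0 : 'I_N) (U P : 'M[R[i]]_N) : (1 < N)%N ->
  i0 = 0%N :> nat -> U \is unitarymx -> P \is unitarymx ->
  quantum_risk mu U (U *m (P^t* *m flip0 _ i0 *m P)) <> 0.
Proof.
move=> N1 i00 uU uP; set W := P^t* *m _ *m P.
rewrite /quantum_risk mulmxA unitarymxKl// mul1mx => /eqP.
rewrite subr_eq0 eq_sym => /eqP risk0.
have mS := @pure_states_measurable R N.
(* Zero risk means that the overlap, at most 1 on pure states, has integral 1. *)
have lossy0 : mu (lossy_states (flip0 R[i] i0)) = 0%E.
  rewrite -(lossy_states_conj _ uP).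
  apply: Rintegral_eq1_ae risk0 => //; [exact: hmu.1|exact: overlap_measurable|].
  move=> psi Spsi; apply: overlap_le1; rewrite /W.
  have := unitary_unit_sphere uP Spsi; move/(flip0_form_le1 i0).
  by rewrite trmxC_mul !mulmxA.
have lossyP (X : 'M[R[i]]_N) : X \is unitarymx ->
    mu.-negligible (lossy_states (X^t* *m flip0 _ i0 *m X)).
  move=> uX; apply/negligibleP; first exact: lossy_states_measurable.
  by rewrite -lossy0; exact: lossy_states_conj.
have lossyE (X : 'M[R[i]]_N) (psi : 'cV[R[i]]_N) :
    X \is unitarymx -> psi^t* *m psi = 1%:M ->
    ~ lossy_states (X^t* *m flip0 _ i0 *m X) psi ->
    `|(X *m psi) i0 0| ^+ 2 \in [:: 0; 1].
  move=> uX Spsi nl; apply: flip0_form_norm1; first exact: unitary_unit_sphere.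
  have : overlap (X^t* *m flip0 _ i0 *m X) psi = 1.
    by apply: contrapT => h; exact: nl.
  by move/overlap_eq1; rewrite trmxC_mul !mulmxA.
have [Xw uXw Xw0] := unitary_row0 i00 (uniform_vector_unit R[i] (ltnW N1)).
have /choice[X XP] : forall i : 'I_N, exists X : 'M[R[i]]_N, X \is unitarymx /\
    forall psi : 'cV[R[i]]_N, `|(X *m psi) i0 0| = `|psi i 0|.
  move=> i; have [X uX X0] := unitary_row0 i00 (delta_unit R[i] i).
  by exists X; split => // psi; rewrite X0 delta_adj_mul.
(* X i sends |psi_i| to coordinate i0, and Xw the overlap with the uniform
   vector: no unit vector has all these squared moduli in {0, 1}. *)
pose F k := if insub k is Some i then lossy_states ((X i)^t* *m flip0 _ i0 *m X i)
            else lossy_states (Xw^t* *m flip0 _ i0 *m Xw).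
have Fn : mu.-negligible (\bigcup_k F k).
  apply: negligible_bigcup => k; rewrite /F; case: insub => [i|];
    apply: lossyP => //.
  by have [] := XP i.
(* No pure state lies outside the null union of the [F k], so the sphere itself would be null,
   although it has mass 1. *)
have : mu.-negligible (@pure_states R N).
  apply: negligibleS Fn => psi Spsi; apply: contrapT => nF.
  have pi i : `|(psi : 'cV[R[i]]_N) i 0| ^+ 2 \in [:: 0; 1].
    have [uX <-] := XP i; apply: lossyE => // l; apply: nF.
    by exists i => //; rewrite /F valK.
  have := flat_vector_contra N1 Spsi pi; apply/negP; rewrite negbK.
  rewrite -uniform_vector_overlap -Xw0.
  (* The index [N] is not in ['I_N], so [F N] is the set attached to [Xw]. *)
  apply: lossyE => // l; apply: nF; exists N => //.
  by rewrite /F insubF// ltnn.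
move=> /negligibleP => /(_ mS) S0.
by have := hmu.1; rewrite S0 => -[/esym/eqP]; rewrite oner_eq0.
Qed.

End Haar.

(** * Density matrices and sufficiency of datasets *)

Lemma density_projector (R : realType) N (u : 'cV[R[i]]_N) :
  u^t* *m u = 1%:M -> density (u *m u^t*).
Proof.
move=> uu; split; last by rewrite mxtrace_mulC uu mxtrace1.
  by apply/is_hermitianmxP; rewrite expr0 scale1r trmxC_mul trmxCK.
move=> v; rewrite mulmxA -mulmxA -[v^t* *m u]trmxCK trmxC_mul trmxCK.
by rewrite mxE big_ord1 !mxE mulrC mul_conjC_ge0.
Qed.

Lemma density_diag (R : realType) N (d : 'rV[R[i]]_N) :
  (forall i, 0 <= d 0 i) -> \sum_i d 0 i = 1 -> density (diag_mx d).
Proof.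
move=> d0 d1; split; last by rewrite mxtrace_diag.
  apply/is_hermitianmxP; rewrite expr0 scale1r tr_diag_mx map_diag_mx.
  by congr diag_mx; apply/rowP => i; rewrite !mxE/= conj_Creal// ger0_real.
move=> v; rewrite mul_mx_diag mxE; apply: sumr_ge0 => i _.
by rewrite !mxE mulrAC mulr_ge0// mulrC mul_conjC_ge0.
Qed.

Lemma perfectly_trained_conj (R : realType) N (rho U V : 'M[R[i]]_N) :
  U \is unitarymx -> V \is unitarymx ->
  V *m rho *m V^t* = U *m rho *m U^t* ->
  (U^t* *m V) *m rho = rho *m (U^t* *m V).
Proof.
move=> uU uV /(congr1 (fun M => U^t* *m M *m V)).
by rewrite !mulmxA mulmxKtV// unitarymxKl// mul1mx.
Qed.

Lemma two_states_sufficient (R : realType) N (mu : probability (cvect R N) R) :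
  haar_pure_state mu -> (0 < N)%N ->
  exists rho sigma : 'M[R[i]]_N, [/\ density rho, density sigma &
    forall U : 'M[R[i]]_N, U \is unitarymx ->
      sufficient mu (training_dataset U [:: rho; sigma]) U].
Proof.
move=> hmu N0.
(* The eigenvalues [1/c, ..., N/c] are distinct with sum 1. Starting from 1 instead of 0 keeps [c]
   positive even for [N = 1]. *)
pose c : R[i] := \sum_(i < N) i.+1%:R.
have c0 : 0 < c.
  rewrite /c (bigD1 (Ordinal N0))//= ltr_wpDr ?ltr01//.
  by apply: sumr_ge0 => i _; exact: ler0n.
pose d : 'rV[R[i]]_N := \row_i (i.+1%:R / c).
exists (diag_mx d), (uniform_vector R[i] N *m (uniform_vector R[i] N)^t*); split.
- apply: density_diag => [i|]; first by rewrite mxE divr_ge0 ?ler0n// ltW.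
  by under eq_bigr do rewrite mxE; rewrite -mulr_suml mulfV// gt_eqF.
- exact/density_projector/uniform_vector_unit.
move=> U uU V uV tV; apply: quantum_risk_scalar => //.
have tE rho : rho \in [:: diag_mx d;
      uniform_vector R[i] N *m (uniform_vector R[i] N)^t*] ->
    (U^t* *m V) *m rho = rho *m (U^t* *m V).
  move=> rhoin; apply: perfectly_trained_conj => //.
  exact: (tV (rho, _) (map_f _ rhoin)).
apply: (@commute_diag_const_scalar _ _ d N%:R^-1).
- by rewrite invr_eq0 pnatr_eq0 -lt0n.
- move=> i j; rewrite !mxE => /(mulIf _) -/(_ (invr_neq0 (lt0r_neq0 c0))) /eqP.
  by rewrite eqr_nat eqSS => /eqP /val_inj.
- by apply: tE; rewrite inE eqxx.
by rewrite -uniform_vector_projector; apply: tE; rewrite !inE eqxx orbT.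
Qed.

Lemma one_state_insufficient (R : realType) N (mu : probability (cvect R N) R)
    (rho U : 'M[R[i]]_N) :
  haar_pure_state mu -> (1 < N)%N -> density rho -> U \is unitarymx ->
  ~ sufficient mu (training_dataset U [:: rho]) U.
Proof.
move=> hmu N1 [hrho _ _] uU suf; pose i0 := Ordinal (ltnW N1).
have [P uP /= WA] := hermitian_flip i0 hrho.
have uW : P^t* *m flip0 _ i0 *m P \is unitarymx.
  by rewrite !mul_unitarymx ?trmxC_unitary ?flip0_unitary.
(* The badly generalizing model is [V = U W], with [W] the reflection in an eigenbasis of [rho]; it
   is perfectly trained because [W rho W^* = rho]. *)
apply: (flip0_risk_neq0 hmu N1 (erefl : i0 = 0%N :> nat) uU uP).
apply: suf; first by rewrite mul_unitarymx.
move=> p; rewrite inE => /eqP -> /=.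
by rewrite trmxC_mul -[in RHS]WA !mulmxA.
Qed.

Theorem mainTheorem2 (R : realType) (n : nat) (hn : (1 <= n)%N)
    (mu : probability (cvect R (2 ^ n)) R) (hmu : haar_pure_state mu) :
  [/\ forall U : 'M[R[i]]_(2 ^ n), U \is unitarymx ->
        is_minimum (sufficient_size mu U) 2,
      exists rho sigma : 'M[R[i]]_(2 ^ n),
        [/\ density rho, density sigma &
            forall U : 'M[R[i]]_(2 ^ n), U \is unitarymx ->
              sufficient mu (training_dataset U [:: rho; sigma]) U]
    & forall (rho U : 'M[R[i]]_(2 ^ n)), density rho -> U \is unitarymx ->
        ~ sufficient mu (training_dataset U [:: rho]) U].
Proof.
have N1 : (1 < 2 ^ n)%N by rewrite -{1}(expn0 2) ltn_exp2l.
have N0 : (0 < 2 ^ n)%N := ltnW N1.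
have two := two_states_sufficient hmu N0.
have one := one_state_insufficient hmu N1.
split=> [U uU||rho U hrho uU]; [|exact: two|exact: one].
have [rho [sigma [hrho hsigma suf]]] := two.
split.
  exists [:: rho; sigma]; split=> // [tau|]; last exact: suf.
  by rewrite !inE => /orP[] /eqP ->.
move=> [|[|//]] [[|tau [|? ?]] [//= _ dens suf']].
  (* Every unitary is perfectly trained on the empty dataset, so its sufficiency would make the
     dataset of the single state [rho] sufficient too. *)
  by case: (one rho U hrho uU) => V uV _; apply: suf'.
by case: (one tau U (dens _ (mem_head _ _)) uU).
Qed.
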